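(* Let $G$ be a directed graph with finitely many vertices and let $G=G_1\cup G_2$, where $G_1,G_2$ are non-empty subgraphs of $G$ that share only some vertices but no edges. Suppose that $G_2^0\neq G^0$ and no edge of $G_2$ enters $G_1$. Let $v_1,\dots,v_n$ be the vertices shared by $G_1$ and $G_2$ (so $n$ is their number). For a vertex $v$ of $G_1$ let $\bar p_v$ denote the corresponding projection in $C^*(G_1)$, and for a vertex $v$ of $G_2$ let $\bar{\bar p}_v$ denote the corresponding projection in $C^*(G_2)$. Then $$C^*(G)\cong \left(C^*(G_1)\oplus\mathbb C\right)\ast_{\mathbb C^{n+2}} \left(C^*(G_2)\oplus\mathbb C\right),$$ where the right-hand side is the unital full amalgamated free product with respect to the unital embeddings $\theta_1:\mathbb C^{n+2}\to C^*(G_1)\oplus\mathbb C$ and $\theta_2:\mathbb C^{n+2}\to C^*(G_2)\oplus\mathbb C$ defined by $$\theta_1(\lambda_1,\dots,\lambda_{n+2})=\Big(\sum_{i=1}^n\lambda_i\bar p_{v_i}+\lambda_{n+1}\sum_{v\in G_1^0\setminus G_2^0}\bar p_v,\ \lambda_{n+2}\Big),$$ $$\theta_2(\lambda_1,\dots,\lambda_{n+2})=\Big(\sum_{i=1}^n\lambda_i\bar{\bar p}_{v_i}+\lambda_{n+2}\sum_{v\in G_2^0\setminus G_1^0}\bar{\bar p}_v,\ \lambda_{n+1}\Big)$$ for $\lambda_1,\dots,\lambda_{n+2}\in\mathbb C$.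
   Context: A directed graph $G=(G^0,G^1,s,r)$ consists of countable sets $G^0$ (vertices) and $G^1$ (edges) and maps $s,r:G^1\to G^0$ (source and range). The graph C*-algebra $C^*(G)$ is the universal C*-algebra generated by mutually orthogonal projections $p_v$ ($v\in G^0$) and partial isometries $s_e$ ($e\in G^1$) with mutually orthogonal ranges, subject to: (1) $s_e^*s_e=p_{s(e)}$ for each $e\in G^1$; (2) $p_v=\sum_{e\in r^{-1}(v)}s_es_e^*$ for each $v\in G^0$ with $0<\sharp(r^{-1}(v))<\infty$; (3) $s_es_e^*\le p_{r(e)}$ for each $e\in G^1$. If $G^0$ is finite, $C^*(G)$ is unital with unit $\sum_{v}p_v$. $G=G_1\cup G_2$ means that $G_1,G_2$ are subgraphs with $G^0=G_1^0\cup G_2^0$ and $G^1=G_1^1\cup G_2^1$. ''No edge of $G_2$ enters $G_1$'' means that $r(e)\notin G_1^0$ for every $e\in G_2^1$. Given unital C*-algebras $A,B,D$ and unital embeddings $\theta_A:D\to A$, $\theta_B:D\to B$, the unital full amalgamated free product $A\ast_D B$ is the C*-algebra $C$ equipped with unital embeddings $i_A:A\to C$, $i_B:B\to C$ with $i_A\circ\theta_A=i_B\circ\theta_B$, generated by $i_A(A)\cup i_B(B)$, such that whenever $\mathcal E$ is a unital C*-algebra and $\pi_A:A\to\mathcal E$, $\pi_B:B\to\mathcal E$ are unital $*$-homomorphisms with $\pi_A\circ\theta_A=\pi_B\circ\theta_B$, there is a unital $*$-homomorphism $\pi:C\to\mathcal E$ with $\pi\circ i_A=\pi_A$ and $\pi\circ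 i_B=\pi_B$. *)

(* Defs.v *)
From HB Require Import structures.
From mathcomp Require Import all_boot all_order all_algebra complex.
From mathcomp Require Import boolp classical_sets functions cardinality fsbigop.
From mathcomp Require Import reals topology interval_inference.
From mathcomp Require Import prodnormedzmodule normedtype.

Set Implicit Arguments.
Unset Strict Implicit.
Unset Printing Implicit Defensive.

Import Order.TTheory GRing.Theory Num.Theory.
Import numFieldNormedType.Exports.
Local Open Scope classical_set_scope.
Local Open Scope ring_scope.

Section ComplexComplete.
Variable R : realType.

Lemma normc_i : `|'i%C : R[i]| = 1.
Proof. by rewrite normc_def/= expr0n expr1n add0r sqrtr1. Qed.

Lemma normc_ge_Im (x : R[i]) : `|complex.Im x|%:C%C <= `|x|.
Proof.
have -> : `|x| = `|x * 'i%C| by rewrite normrM normc_i mulr1.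
by rewrite -[complex.Im x]opprK -ReiNIm normrN normc_ge_Re.
Qed.

Lemma complex_complete (F : set_system R[i]^o) :
  ProperFilter F -> cauchy F -> cvg F.
Proof.
move=> FF /cauchy_ballP Fc.
have cvgf (f : R[i]^o -> R) :
    (forall x y, `|f x - f y|%:C%C <= `|x - y|) -> cvg (f @ F).
  move=> fle; apply: cauchy_cvg; apply/cauchy_ballP => e e0.
  have e0' : 0 < e%:C%C :> R[i] by rewrite ltcR.
  have [[A B] /= [FA FB] AB] := Fc _ e0'.
  exists (f @` A, f @` B) => /=.
    by split; [apply: filterS FA|apply: filterS FB] => x ?; exists x.
  move=> [_ _] /= [[x Ax <-] [y By <-]].
  have : ball x e%:C%C y by exact: (AB (x, y)).
  rewrite -!ball_normE /ball_ /= => xy.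
  by rewrite -ltcR; exact: le_lt_trans (fle _ _) xy.
pose re : R[i]^o -> R := @complex.Re R; pose im : R[i]^o -> R := @complex.Im R.
have cr : re @ F --> lim (re @ F).
  by apply: cvgf => -[a b] [c d]; exact: (normc_ge_Re (Complex (a - c) (b - d))).
have ci : im @ F --> lim (im @ F).
  by apply: cvgf => -[a b] [c d]; exact: (normc_ge_Im (Complex (a - c) (b - d))).
set a := lim _ in cr; set b := lim _ in ci.
apply/cvg_ex; exists (Complex a b).
apply/cvgrPdist_le => e e0.
have eE : e = (complex.Re e)%:C%C by rewrite RRe_real// gtr0_real.
have e20 : 0 < complex.Re e / 2 by rewrite divr_gt0// -ltcR -eE.
move/cvgrPdist_le/(_ _ e20) : cr => cr; move/cvgrPdist_le/(_ _ e20) : ci => ci.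
near=> x.
have -> : Complex a b - x = Complex (a - complex.Re x) (b - complex.Im x).
  by case: (x).
rewrite [Complex _ _]complexE/=; apply: (le_trans (ler_normD _ _)).
rewrite normrM normc_i mul1r.
rewrite !normc_def/= !expr0n !addr0 !sqrtr_sqr eE -rmorphD lecR [leRHS]splitr.
by apply: lerD; near: x.
Unshelve. all: by end_near. Qed.

(* The library gives the generic ring R^o its canonical completeness only for a
   realType, so the Banach space structure of the complex numbers is put on
   R[i] itself, as the library does for R. *)
HB.instance Definition _ := NormedModule.copy R[i] R[i]^o.
HB.instance Definition _ := Uniform_isComplete.Build R[i] complex_complete.
HB.instance Definition _ (m n : nat) := Complete.on 'M[R[i]]_(m, n).

End ComplexComplete.

Section ProdComplete.
Variables (K : numFieldType) (U V : completeNormedModType K).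

HB.instance Definition _ := Pointed.on (U * V)%type.

Lemma prod_complete (F : set_system (U * V)) :
  ProperFilter F -> cauchy F -> cvg F.
Proof.
move=> FF /cauchy_ballP Fc.
have cvgf (W : completeNormedModType K) (f : U * V -> W) :
    (forall x y e, ball x e y -> ball (f x) e (f y)) -> cvg (f @ F).
  move=> fb; apply: cauchy_cvg; apply/cauchy_ballP => e e0.
  have [[A B] /= [FA FB] AB] := Fc _ e0.
  exists (f @` A, f @` B) => /=.
    by split; [apply: filterS FA|apply: filterS FB] => x ?; exists x.
  by move=> [_ _] /= [[x Ax <-] [y By <-]]; apply: fb; exact: (AB (x, y)).
have cu : cvg (fst @ F) by apply: cvgf => x y e [].
have cv : cvg (snd @ F) by apply: cvgf => x y e [].
apply/cvg_ex; exists (lim (fst @ F), lim (snd @ F)).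
suff : (fun x : U * V => (x.1, x.2)) @ F --> (lim (fst @ F), lim (snd @ F)).
  by rewrite (_ : (fun x => _) = id)//; apply/funext => -[].
exact: cvg_pair.
Qed.

HB.instance Definition _ := Uniform_isComplete.Build (U * V)%type prod_complete.

End ProdComplete.

(* C*-algebras need not be unital, so the product cannot be that of the
   MathComp ring hierarchy, whose rings all have a unit. *)
HB.mixin Record NormedModule_isCStarAlgebra (R : realType) A
    of CompleteNormedModule R[i] A := {
  cmul : A -> A -> A ;
  star : A -> A ;
  cmulA : associative cmul ;
  cmulDl : left_distributive cmul +%R ;
  cmulDr : right_distributive cmul +%R ;
  cscalerAl : forall (k : R[i]) (a b : A), k *: cmul a b = cmul (k *: a) b ;
  cscalerAr : forall (k : R[i]) (a b : A), k *: cmul a b = cmul a (k *: b) ;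
  starK : involutive star ;
  starD : {morph star : a b / a + b} ;
  starZ : forall (k : R[i]) (a : A), star (k *: a) = conjc k *: star a ;
  starM : forall a b : A, star (cmul a b) = cmul (star b) (star a) ;
  cnormM_le : forall a b : A, `|cmul a b| <= `|a| * `|b| ;
  cstar_identity : forall a : A, `|cmul (star a) a| = `|a| ^+ 2
}.

#[short(type="cstarAlgType")]
HB.structure Definition CStarAlgebra (R : realType) :=
  {A of NormedModule_isCStarAlgebra R A & CompleteNormedModule R[i] A}.

Arguments cmul {R s} : simpl never.
Arguments star {R s} : simpl never.

Notation "x ** y" := (cmul x y) (at level 40, left associativity) : ring_scope.

Section ComplexCStar.
Variable R : realType.
Implicit Types (k a b : R[i]).

Fact complex_mulA : associative (fun a b : R[i] => a * b).
Proof. exact: mulrA. Qed.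
Fact complex_mulDl : left_distributive (fun a b : R[i] => a * b) +%R.
Proof. exact: mulrDl. Qed.
Fact complex_mulDr : right_distributive (fun a b : R[i] => a * b) +%R.
Proof. exact: mulrDr. Qed.
Fact complex_scalerAl k a b : k *: (a * b) = (k *: a) * b.
Proof. exact: mulrA. Qed.
Fact complex_scalerAr k a b : k *: (a * b) = a * (k *: b).
Proof. exact: mulrCA. Qed.
Fact complex_starK : involutive (@conjc R).
Proof. exact: conjcK. Qed.
Fact complex_starD : {morph @conjc R : a b / a + b}.
Proof. exact: rmorphD. Qed.
Fact complex_starZ k a : conjc (k *: a) = conjc k *: conjc a.
Proof. exact: (rmorphM (@conjc R)). Qed.
Fact complex_starM a b : conjc (a * b) = conjc b * conjc a.
Proof. by rewrite mulrC rmorphM. Qed.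
Fact complex_normM_le a b : `|a * b| <= `|a| * `|b|.
Proof. by rewrite normrM. Qed.
Fact complex_cstar_identity a : `|conjc a * a| = `|a| ^+ 2.
Proof. by rewrite mulrC -sqr_normc normrX normr_id. Qed.

HB.instance Definition _ := NormedModule_isCStarAlgebra.Build R R[i]
  complex_mulA complex_mulDl complex_mulDr complex_scalerAl complex_scalerAr complex_starK
  complex_starD complex_starZ complex_starM complex_normM_le
  complex_cstar_identity.

End ComplexCStar.

Section ProdCStar.
Variables (R : realType) (A B : cstarAlgType R).
Implicit Types (k : R[i]) (x y z : A * B).

Definition prod_cmul x y : A * B := (x.1 ** y.1, x.2 ** y.2).
Definition prod_star x : A * B := (star x.1, star x.2).

Fact prod_cmulA : associative prod_cmul.
Proof. by move=> x y z; congr pair; exact: cmulA. Qed.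
Fact prod_cmulDl : left_distributive prod_cmul +%R.
Proof. by move=> x y z; congr pair; exact: cmulDl. Qed.
Fact prod_cmulDr : right_distributive prod_cmul +%R.
Proof. by move=> x y z; congr pair; exact: cmulDr. Qed.
Fact prod_cscalerAl k x y : k *: prod_cmul x y = prod_cmul (k *: x) y.
Proof. by congr pair; exact: cscalerAl. Qed.
Fact prod_cscalerAr k x y : k *: prod_cmul x y = prod_cmul x (k *: y).
Proof. by congr pair; exact: cscalerAr. Qed.
Fact prod_starK : involutive prod_star.
Proof. by move=> [a b]; congr pair; exact: starK. Qed.
Fact prod_starD : {morph prod_star : x y / x + y}.
Proof. by move=> x y; congr pair; exact: starD. Qed.
Fact prod_starZ k x : prod_star (k *: x) = conjc k *: prod_star x.
Proof. by congr pair; exact: starZ. Qed.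
Fact prod_starM x y :
  prod_star (prod_cmul x y) = prod_cmul (prod_star y) (prod_star x).
Proof. by congr pair; exact: starM. Qed.
Fact prod_norm_le x (M : R[i]) : `|x.1| <= M -> `|x.2| <= M -> `|x| <= M.
Proof. by rewrite prod_normE/= maxEle => ? ?; case: ifP. Qed.
Fact prod_norm1 x : `|x.1| <= `|x|.
Proof.
rewrite prod_normE/= comparable_le_max ?lexx//.
by apply: real_comparable; exact: normr_real.
Qed.
Fact prod_norm2 x : `|x.2| <= `|x|.
Proof.
rewrite prod_normE/= comparable_le_max ?lexx ?orbT//.
by apply: real_comparable; exact: normr_real.
Qed.
Fact prod_cnormM_le x y : `|prod_cmul x y| <= `|x| * `|y|.
Proof.
apply: prod_norm_le; apply: (le_trans (cnormM_le _ _)); apply: ler_pM => //;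
  by [exact: prod_norm1|exact: prod_norm2].
Qed.
Fact prod_cstar_identity x : `|prod_cmul (prod_star x) x| = `|x| ^+ 2.
Proof.
apply/eqP; rewrite eq_le; apply/andP; split.
  apply: prod_norm_le; rewrite cstar_identity lerXn2r ?nnegrE//.
    exact: prod_norm1.
  exact: prod_norm2.
rewrite {1}[ `|x| ]prod_normE maxEle; case: ifP => _; rewrite -cstar_identity.
  exact: (prod_norm2 (prod_cmul (prod_star x) x)).
exact: (prod_norm1 (prod_cmul (prod_star x) x)).
Qed.

HB.instance Definition _ := NormedModule_isCStarAlgebra.Build R (A * B)%type
  prod_cmulA prod_cmulDl prod_cmulDr prod_cscalerAl prod_cscalerAr prod_starK
  prod_starD prod_starZ prod_starM prod_cnormM_le prod_cstar_identity.

End ProdCStar.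

Section RowCStar.
Variables (R : realType) (m : nat).
Implicit Types (k : R[i]) (x y z : 'rV[R[i]]_m).

Definition row_cmul x y : 'rV[R[i]]_m := \row_j (x 0 j * y 0 j).
Definition row_star x : 'rV[R[i]]_m := \row_j conjc (x 0 j).

Fact row_cmulA : associative row_cmul.
Proof. by move=> x y z; apply/rowP => j; rewrite !mxE mulrA. Qed.
Fact row_cmulDl : left_distributive row_cmul +%R.
Proof. by move=> x y z; apply/rowP => j; rewrite !mxE mulrDl. Qed.
Fact row_cmulDr : right_distributive row_cmul +%R.
Proof. by move=> x y z; apply/rowP => j; rewrite !mxE mulrDr. Qed.
Fact row_cscalerAl k x y : k *: row_cmul x y = row_cmul (k *: x) y.
Proof. by apply/rowP => j; rewrite !mxE mulrA. Qed.
Fact row_cscalerAr k x y : k *: row_cmul x y = row_cmul x (k *: y).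
Proof. by apply/rowP => j; rewrite !mxE mulrCA. Qed.
Fact row_starK : involutive row_star.
Proof. by move=> x; apply/rowP => j; rewrite !mxE conjcK. Qed.
Fact row_starD : {morph row_star : x y / x + y}.
Proof. by move=> x y; apply/rowP => j; rewrite !mxE rmorphD. Qed.
Fact row_starZ k x : row_star (k *: x) = conjc k *: row_star x.
Proof. by apply/rowP => j; rewrite !mxE rmorphM. Qed.
Fact row_starM x y : row_star (row_cmul x y) = row_cmul (row_star y) (row_star x).
Proof. by apply/rowP => j; rewrite !mxE rmorphM mulrC. Qed.
Fact row_norm_coord x j : `|x 0 j| <= `|x|.
Proof.
rewrite [ `|x| ]mx_normE -[leLHS]nngE num_le.
exact: (@le_bigmax _ _ _ 0%:nng (fun i : 'I_1 * 'I_m => `|x i.1 i.2|%:nng) (0, j)).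
Qed.
Fact row_norm_le x (M : R[i]) : 0 <= M -> (forall j, `|x 0 j| <= M) -> `|x| <= M.
Proof.
move=> M0 xM; have [x0|/mx_norm_neq0[[i j] /= xE]] := eqVneq (mx_norm x) 0.
  by rewrite [ `|x| ]x0.
by rewrite [ `|x| ]xE ord1.
Qed.
Fact row_cnormM_le x y : `|row_cmul x y| <= `|x| * `|y|.
Proof.
apply: row_norm_le => [|j]; first exact: mulr_ge0.
by rewrite mxE normrM; apply: ler_pM => //; exact: row_norm_coord.
Qed.
Fact row_cstar_identity x : `|row_cmul (row_star x) x| = `|x| ^+ 2.
Proof.
apply/eqP; rewrite eq_le; apply/andP; split.
  apply: row_norm_le => [|j]; first exact: exprn_ge0.
  by rewrite !mxE complex_cstar_identity lerXn2r ?nnegrE//; exact: row_norm_coord.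
have [x0|/mx_norm_neq0[[i j] /= xE]] := eqVneq (mx_norm x) 0.
  by rewrite (_ : `|x| = 0)// expr0n/= normr_ge0.
rewrite {1}[ `|x| ]xE ord1 -complex_cstar_identity.
by have := row_norm_coord (row_cmul (row_star x) x) j; rewrite !mxE.
Qed.

HB.instance Definition _ := NormedModule_isCStarAlgebra.Build R 'rV[R[i]]_m
  row_cmulA row_cmulDl row_cmulDr row_cscalerAl row_cscalerAr row_starK
  row_starD row_starZ row_starM row_cnormM_le row_cstar_identity.

End RowCStar.

Section StarMaps.
Variable R : realType.
Implicit Types A B : cstarAlgType R.

Definition star_hom A B (f : A -> B) : Prop :=
  [/\ linear f, {morph f : a b / a ** b} & {morph f : a / star a}].

Definition is_unit A (e : A) : Prop := forall a : A, e ** a = a /\ a ** e = a.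

(* In particular A and B are unital. *)
Definition unital_star_hom A B (f : A -> B) : Prop :=
  star_hom f /\ exists2 e : A, is_unit e & is_unit (f e).

Definition unital_embedding A B (f : A -> B) : Prop :=
  unital_star_hom f /\ injective f.

Definition star_isomorphic A B : Prop :=
  exists2 f : A -> B, star_hom f & bijective f.

Definition star_subalgebra A (S : set A) : Prop :=
  [/\ S 0, forall (k : R[i]) a b, S a -> S b -> S (k *: a + b),
      forall a b, S a -> S b -> S (a ** b) & forall a, S a -> S (star a)].

(* The smallest closed *-subalgebra containing X is the whole algebra. *)
Definition generates A (X : set A) : Prop :=
  forall S : set A, closed S -> star_subalgebra S -> X `<=` S -> S = setT.

Definition is_projection A (p : A) : Prop := p ** p = p /\ star p = p.

Definition proj_orthogonal A (p q : A) : Prop := p ** q = 0.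

(* The order of projections; for the other elements it is not the C*-order. *)
Definition proj_le A (p q : A) : Prop := q ** p = p.

Definition partial_isometry A (s : A) : Prop := s ** star s ** s = s.

End StarMaps.

(* C, with iA and iB, is the unital full free product of A and B amalgamated
   over D along thA and thB. The notion is intended for unital embeddings thA
   and thB, but it makes sense for arbitrary maps, so no hypothesis on them is
   built in. *)
Record amalgamated_free_product (R : realType) (D A B C : cstarAlgType R)
    (thA : D -> A) (thB : D -> B) (iA : A -> C) (iB : B -> C) : Prop := {
  afp_embA : unital_embedding iA ;
  afp_embB : unital_embedding iB ;
  afp_amalg : iA \o thA =1 iB \o thB ;
  afp_gen : generates (range iA `|` range iB) ;
  afp_univ : forall (E : cstarAlgType R) (piA : A -> E) (piB : B -> E),
    unital_star_hom piA -> unital_star_hom piB ->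
    piA \o thA =1 piB \o thB ->
    exists pi : C -> E,
      [/\ unital_star_hom pi, pi \o iA =1 piA & pi \o iB =1 piB]
}.

Record digraph (V E : countType) := Digraph { src : E -> V ; rng : E -> V }.

Section GraphAlgebra.
Variables (R : realType) (V E : countType) (G : digraph V E).

Record graph_family (A : cstarAlgType R) (p : V -> A) (s : E -> A) : Prop := {
  gf_proj : forall v, is_projection (p v) ;
  gf_proj_orth : forall v w, v != w -> proj_orthogonal (p v) (p w) ;
  gf_pisom : forall e, partial_isometry (s e) ;
  gf_range_orth : forall e f, e != f ->
    proj_orthogonal (s e ** star (s e)) (s f ** star (s f)) ;
  gf_source : forall e, star (s e) ** s e = p (src G e) ;
  gf_vertex : forall v, let rv := rng G @^-1` [set v] in
    rv !=set0 -> finite_set rv ->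
    p v = \sum_(e \in rv) (s e ** star (s e)) ;
  gf_range : forall e, proj_le (s e ** star (s e)) (p (rng G e))
}.

(* A, with p and s, is the graph C*-algebra of G. *)
Record graph_algebra (A : cstarAlgType R) (p : V -> A) (s : E -> A) : Prop := {
  ga_family : graph_family p s ;
  ga_gen : generates (range p `|` range s) ;
  ga_univ : forall (B : cstarAlgType R) (q : V -> B) (t : E -> B),
    graph_family q t ->
    exists pi : A -> B, [/\ star_hom pi, pi \o p =1 q & pi \o s =1 t]
}.

Record subgraph := Subgraph {
  sg_vert : pred V ;
  sg_edge : pred E ;
  sg_src : forall e, sg_edge e -> sg_vert (src G e) ;
  sg_rng : forall e, sg_edge e -> sg_vert (rng G e)
}.

Definition subgraph_digraph (H : subgraph) :
    digraph {v : V | sg_vert H v} {e : E | sg_edge H e} :=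
  Digraph (fun e => exist _ (src G (val e)) (sg_src (valP e)))
          (fun e => exist _ (rng G (val e)) (sg_rng (valP e))).

End GraphAlgebra.

(* The maps C^(n+2) -> C*(G1) (+) C and C^(n+2) -> C*(G2) (+) C. The family v
   enumerates the shared vertices, and the columns lshift 2 i, rshift n ord0 and
   rshift n ord_max hold lambda_i (i <= n), lambda_(n+1) and lambda_(n+2). *)
Section Theta.
Variables (R : realType) (V : finType) (E : countType) (G : digraph V E).
Variables (G1 G2 : subgraph G) (n : nat) (v : 'I_n -> V).

Definition theta1 (A : cstarAlgType R) (p : {x : V | sg_vert G1 x} -> A)
    (vG1 : forall i, sg_vert G1 (v i)) (l : 'rV[R[i]]_(n + 2)) : A * R[i] :=
  (\sum_(i < n) l 0 (lshift 2 i) *: p (exist _ (v i) (vG1 i)) +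
     l 0 (rshift n ord0) *:
       \sum_(x : {x : V | sg_vert G1 x} | ~~ sg_vert G2 (val x)) p x,
   l 0 (rshift n ord_max)).

Definition theta2 (B : cstarAlgType R) (p : {x : V | sg_vert G2 x} -> B)
    (vG2 : forall i, sg_vert G2 (v i)) (l : 'rV[R[i]]_(n + 2)) : B * R[i] :=
  (\sum_(i < n) l 0 (lshift 2 i) *: p (exist _ (v i) (vG2 i)) +
     l 0 (rshift n ord_max) *:
       \sum_(x : {x : V | sg_vert G2 x} | ~~ sg_vert G1 (val x)) p x,
   l 0 (rshift n ord0)).

End Theta.

(* Main.v *)
Require Import Defs.
From HB Require Import structures.
From mathcomp Require Import all_boot all_order all_algebra complex.
From mathcomp Require Import boolp classical_sets cardinality fsbigop.
From mathcomp Require Import reals topology normedtype sequences.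

(** Both sides are universal for the same data. A map out of the free product
    is a pair of unital maps out of C*(G1) (+) C and C*(G2) (+) C that agree on
    C^(n+2), and a map out of C*(G) is a Cuntz-Krieger family for G; so it is
    enough to translate one kind of datum into the other, and to compare on
    generators.

    Since no edge of G2 enters G1, the edges of G that enter a given vertex are
    either all in G1 or all in G2 ([range_saturated]). Hence the sum relation at
    a vertex that receives an edge is the same in G and in the subgraph that
    contains this edge. It follows that a family for G restricts to families for
    G1 and G2 ([graph_family_restrict]) and that, conversely, families for G1
    and G2 which agree on the shared vertices glue to a family for G, as soon as
    the projections of G1 \ G2 are orthogonal to those of G2 \ G1
    ([graph_family_glue]).

    From the free product F to C*(G): C*(G_j) maps to C*(G), and the extra
    summand C goes to the sum of the p_v with v outside G_j. This is unital, and
    the two maps agree on C^(n+2) because lambda_(n+1) multiplies the sum over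
    G1 \ G2 and lambda_(n+2) the sum over G2 \ G1 on both sides. From C*(G) to
    F: glue the two families given by i1 and i2. Amalgamation identifies the
    shared vertices, and it identifies the unit of the extra summand of
    C*(G2) (+) C with the sum of the projections of G1 \ G2; since this unit is
    orthogonal to C*(G2), the orthogonality required for the gluing follows.

    The two composites fix the generators. To conclude that they are identities
    one needs the set where two *-homomorphisms agree to be closed, hence
    automatic continuity ([star_hom_continuous]). The usual proof compares
    spectral radii; the one given here needs only a square root. If a is
    self-adjoint of norm at most 1/2, a contraction argument gives a
    self-adjoint c that commutes with a and satisfies (1 - c)^2 + a^2 = 1. The
    images h and d of a and c satisfy the same relation, so formally
    h + i (1 - d) and h - i (1 - d) are unitary, and h, which is half their sum,
    has norm at most 1. The algebras need not have a unit, so the unitaries are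
    replaced by their action on an element b ([norm_le_rotation]). *)

Set Implicit Arguments.
Unset Strict Implicit.
Unset Printing Implicit Defensive.

Import Order.TTheory GRing.Theory Num.Theory.
Import numFieldNormedType.Exports.
Local Open Scope classical_set_scope.
Local Open Scope ring_scope.

(** * Algebra in a C*-algebra *)

Section CStarBasics.
Variables (R : realType) (A : cstarAlgType R).
Implicit Types (k : R[i]) (a b c : A).

Lemma cmul0l a : 0 ** a = 0.
Proof. by apply: (addrI (0 ** a)); rewrite -cmulDl !addr0. Qed.

Lemma cmul0r a : a ** 0 = 0.
Proof. by apply: (addrI (a ** 0)); rewrite -cmulDr !addr0. Qed.

Lemma cmulNl a b : (- a) ** b = - (a ** b).
Proof. by apply/eqP; rewrite -addr_eq0 -cmulDl addNr cmul0l. Qed.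

Lemma cmulNr a b : a ** (- b) = - (a ** b).
Proof. by apply/eqP; rewrite -addr_eq0 -cmulDr addNr cmul0r. Qed.

Lemma cmulBl a b c : (a - b) ** c = a ** c - b ** c.
Proof. by rewrite cmulDl cmulNl. Qed.

Lemma cmulBr a b c : a ** (b - c) = a ** b - a ** c.
Proof. by rewrite cmulDr cmulNr. Qed.

Lemma cmul_suml (I : Type) (r : seq I) (P : pred I) (F : I -> A) a :
  (\sum_(i <- r | P i) F i) ** a = \sum_(i <- r | P i) F i ** a.
Proof.
exact: (big_morph (fun x => x ** a) (fun x y => cmulDl x y a) (cmul0l a)).
Qed.

Lemma cmul_sumr (I : Type) (r : seq I) (P : pred I) (F : I -> A) a :
  a ** (\sum_(i <- r | P i) F i) = \sum_(i <- r | P i) a ** F i.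
Proof. exact: (big_morph (fun x => a ** x) (cmulDr a) (cmul0r a)). Qed.

Lemma star0 : star (0 : A) = 0.
Proof. by apply: (addrI (star 0)); rewrite -starD !addr0. Qed.

Lemma starN a : star (- a) = - star a.
Proof. by apply/eqP; rewrite -addr_eq0 -starD addNr star0. Qed.

Lemma starB a b : star (a - b) = star a - star b.
Proof. by rewrite starD starN. Qed.

Lemma star_sum (I : Type) (r : seq I) (P : pred I) (F : I -> A) :
  star (\sum_(i <- r | P i) F i) = \sum_(i <- r | P i) star (F i).
Proof. exact: (big_morph _ (@starD R A) star0). Qed.

Lemma norm_star a : `|star a| = `|a|.
Proof.
have le b : `|b| <= `|star b|.
  have [->|b0] := eqVneq b 0; first by rewrite normr0.
  rewrite -(@ler_pM2r _ `|b|) ?normr_gt0// -expr2 -cstar_identity.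
  exact: cnormM_le.
by apply/eqP; rewrite eq_le -{2}[a]starK !le.
Qed.

(** The hypotheses say that u + i v and u - i v both have the same absolute
    value as b, hence the same norm, and u is half their sum. *)
Lemma norm_le_rotation u v b :
  star u ** v = star v ** u -> star u ** u + star v ** v = star b ** b ->
  `|u| <= `|b|.
Proof.
move=> uv uub.
have rot k : conjc k = - k -> k * k = - 1 -> `|u + k *: v| = `|b|.
  move=> kN kk; apply/eqP; rewrite -(@eqrXn2 _ 2)// -!cstar_identity -uub.
  rewrite starD starZ kN cmulDl !cmulDr -!cscalerAr -!cscalerAl uv.
  rewrite !scaleNr scalerN scalerA kk scaleN1r opprK.
  by rewrite addrA addrK.
have i2 : 'i%C * 'i%C = -1 :> R[i] by rewrite -expr2 sqr_i.
have iN : conjc 'i%C = - 'i%C :> R[i]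
  by apply/eqP; rewrite eq_complex /= oppr0 !eqxx.
have -> : u = 2^-1 *: ((u + 'i%C *: v) + (u + (- 'i%C) *: v)).
  rewrite scaleNr addrACA subrr addr0 -mulr2n -(scaler_nat 2 u) scalerA.
  by rewrite mulVf ?scale1r// pnatr_eq0.
rewrite normrZ ger0_norm ?invr_ge0// ler_pdivrMl//.
apply: (le_trans (ler_normD _ _)).
have iN' : conjc (- 'i%C) = - - 'i%C :> R[i].
  by rewrite -[in RHS]iN; exact: (rmorphN (@conjc R)).
by rewrite mulr_natl mulr2n (rot _ iN i2) (rot _ iN') ?mulrNN.
Qed.

End CStarBasics.

(** * Fixed points, closed sets and continuity *)

Section ContractionPrinciple.
Variables (R : realType) (X : completeNormedModType R[i]).

(** A positive complex number is real, so this is the archimedean property of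
    R. *)
Lemma half_expn_lt (e : R[i]) : 0 < e -> exists n, 2^-1 ^+ n < e.
Proof.
move=> e0; have eE : e = (complex.Re e)%:C%C by rewrite RRe_real// gtr0_real.
have r0 : 0 < complex.Re e by rewrite -ltcR -eE.
exists (Num.bound (complex.Re e)^-1); set n := Num.bound _.
have -> : 2^-1 ^+ n = (2^-1 ^+ n)%:C%C :> R[i].
  by rewrite rmorphXn/= fmorphV/= rmorph_nat.
rewrite eE ltcR exprVn invf_plt ?posrE ?exprn_gt0//.
exact: upper_nthrootP.
Qed.

(** As U has diameter at most 1, two iterates of orders at least n differ by at
    most 2^-n, which makes the sequence of iterates Cauchy without summing a
    geometric series. *)
Lemma contraction_fixpoint (U : set X) (f : X -> X) :
  closed U -> U !=set0 -> (forall x, U x -> U (f x)) ->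
  (forall x y, U x -> U y -> `|x - y| <= 1) ->
  (forall x y, U x -> U y -> `|f x - f y| <= 2^-1 * `|x - y|) ->
  exists2 x, U x & f x = x.
Proof.
move=> cU [x0 Ux0] fU diamU fc.
pose y n := iter n f x0.
have Uy n : U (y n) by elim: n => //= n; exact: fU.
have yd n k : `|y n - y (n + k)%N| <= 2^-1 ^+ n.
  elim: n => [|n IH]; first by rewrite expr0 diamU.
  rewrite addSn exprS; apply: (le_trans (fc _ _ (Uy _) (Uy _))).
  by rewrite ler_wpM2l// invr_ge0.
have cy : cvgn y.
  apply: cauchy_cvg; apply: cauchy_exP => e e0.
  have [n ne] := half_expn_lt e0; exists (y n); exists n => // m /= nm.
  by rewrite -ball_normE /ball_ /= -(subnKC nm); exact: le_lt_trans (yd _ _) ne.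
have Ul : U (limn y) by apply: closed_cvg cy => //; exact: nearW.
exists (limn y) => //.
apply: (@cvg_unique _ (@norm_hausdorff _ X) (y n.+1 @[n --> \oo])).
  apply/cvgrPdist_le => e e0;
  move/cvgrPdist_le/(_ _ e0): cy; apply: filterS => n.
  apply: le_trans; apply: (le_trans (fc _ _ Ul (Uy n))).
  by rewrite ler_piMl// invf_le1// ler1n.
by have := cy; rewrite -(cvg_shiftS y (nbhs (limn y))).
Qed.

End ContractionPrinciple.

Lemma closed_fun_eq (K : numFieldType) (X Y : normedModType K) (f g : X -> Y) :
  continuous f -> continuous g -> closed [set x | f x = g x].
Proof.
move=> cf cg.
rewrite (_ : mkset _ = (fun x => f x - g x) @^-1` [set 0]); last first.
  by apply/seteqP; split=> x /= => [->|/subr0_eq//]; rewrite subrr.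
apply: preimage_closed; last first.
  exact: accessible_closed_set1 (hausdorff_accessible (@norm_hausdorff _ Y)) _.
by move=> x _; apply: cvgB; [exact: cf|exact: cg].
Qed.

Lemma closed_norm_le (K : numFieldType) (X : normedModType K) (r : K) :
  0 <= r -> closed [set x : X | `|x| <= r].
Proof.
move=> r0; rewrite -[mkset _]setCK; apply: open_closedC.
rewrite openE => x /= /negP; rewrite -real_ltNge ?ger0_real// -subr_gt0 => xr.
apply/nbhs_ballP; exists (`|x| - r) => //= y.
rewrite -ball_normE /ball_ /= => xy yr.
have := le_lt_trans (ler_normD _ _) (ltr_leD xy yr).
by rewrite !subrK ltxx.
Qed.

Lemma bounded_additive_continuous (K : numFieldType) (X Y : normedModType K)
    (f : X -> Y) (M : K) :
  {morph f : x y / x - y} -> (forall x, `|f x| <= M * `|x|) -> continuous f.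
Proof.
move=> fB fM x; apply/cvgrPdist_lt => e e0.
have M0 : 0 < `|M| + 1 by rewrite ltr_wpDl.
have e1 : 0 < e / (`|M| + 1) by rewrite divr_gt0.
move/cvgrPdist_lt/(_ _ e1): (@cvg_id _ (nbhs x)); apply: filterS => y xy.
rewrite -fB; apply: (le_lt_trans (fM _)).
rewrite ltr_pdivlMr// mulrC in xy; apply: le_lt_trans xy.
have [->|xy0] := eqVneq (x - y) 0; first by rewrite normr0 !mulr0.
have Mr : M \is Num.real.
  have := le_trans (normr_ge0 _) (fM (x - y)).
  by rewrite pmulr_lge0 ?normr_gt0//; exact: ger0_real.
rewrite ler_wpM2r//; apply: (le_trans (real_ler_norm Mr)).
by rewrite lerDl ler01.
Qed.

(** * Automatic continuity of *-homomorphisms *)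

Section CStarContinuity.
Variables (R : realType) (A : cstarAlgType R).
Implicit Types (a b c : A).

Lemma cmul_continuousl a : continuous (fun x => a ** x).
Proof.
apply: (@bounded_additive_continuous _ _ _ _ `|a|) => [x y|x].
  exact: cmulBr.
exact: cnormM_le.
Qed.

Lemma cmul_continuousr a : continuous (fun x => x ** a).
Proof.
apply: (@bounded_additive_continuous _ _ _ _ `|a|) => [x y|x].
  exact: cmulBl.
by rewrite mulrC; exact: cnormM_le.
Qed.

Lemma star_continuous : continuous (@star R A).
Proof.
apply: (@bounded_additive_continuous _ _ _ _ 1) => [x y|x].
  exact: starB.
by rewrite norm_star mul1r.
Qed.

(** The element 1 - c is a square root of 1 - a^2, written without a unit: c is
    the fixed point of c |-> (a^2 + c^2) / 2. This map contracts the ball of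
    radius 1/2 by a factor 1/2, and it preserves the closed condition of being
    self-adjoint and commuting with a. *)
Lemma exists_sqrt_one_minus_square a : star a = a -> `|a| <= 2^-1 ->
  exists c, [/\ star c = c, a ** c = c ** a & c + c - c ** c = a ** a].
Proof.
move=> aa a2; set h := 2^-1 : R[i] in a2.
have h0 : 0 <= h by rewrite invr_ge0.
have hh : h + h = 1 by rewrite -mulr2n -mulr_natr mulVf// pnatr_eq0.
have h1 : h <= 1 by rewrite -hh lerDl.
have Mh x y : `|x| <= h -> `|y| <= h -> `|x ** y| <= h * h.
  by move=> xh yh; apply: (le_trans (cnormM_le _ _)); exact: ler_pM.
have nh x : `|h *: x| = h * `|x| by rewrite normrZ ger0_norm.
pose U := [set c | `|c| <= h] `&` [set c | star c = c] `&`
          [set c | a ** c = c ** a].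
pose T c := h *: (a ** a + c ** c).
have [|||x y|x y|c [[ch cs] ca] cT] := @contraction_fixpoint R A U T.
- apply: closedI; last first.
    apply: closed_fun_eq; [exact: cmul_continuousl|exact: cmul_continuousr].
  apply: closedI; last first.
    by apply: closed_fun_eq; [exact: star_continuous|move=> x; exact: cvg_id].
  exact: closed_norm_le.
- by exists 0; split; [split|]; rewrite /= ?normr0 ?star0 ?cmul0l ?cmul0r.
- move=> x [[xh xs] xa]; split; first split; rewrite /T /=.
  + rewrite nh -[leRHS]mulr1 ler_wpM2l//; apply: (le_trans (ler_normD _ _)).
    apply: (@le_trans _ _ (h * h + h * h));
      by rewrite ?lerD ?Mh// -mulrDr hh mulr1.
  + rewrite starZ starD !starM aa xs; congr (_ *: _).
    by rewrite (_ : h = (2^-1)%:C%C) ?conjc_real// fmorphV rmorph_nat.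
  + rewrite -cscalerAr -cscalerAl cmulDl cmulDr cmulA; congr (_ *: (_ + _)).
    by rewrite cmulA xa -cmulA xa cmulA.
- move=> [[xh _] _] [[yh _] _]; rewrite -hh.
  by apply: (le_trans (ler_normB _ _)); exact: lerD.
- move=> [[xh _] _] [[yh _] _]; rewrite /T -scalerBr nh ler_wpM2l//.
  rewrite [X in `|X|](_ : _ = x ** (x - y) + (x - y) ** y); last first.
    by rewrite opprD addrACA subrr add0r cmulBl cmulBr addrA subrK.
  rewrite -[leRHS]mul1r -hh mulrDl; apply: (le_trans (ler_normD _ _)).
  apply: lerD; apply: (le_trans (cnormM_le _ _)); first exact: ler_wpM2r.
  by rewrite mulrC; exact: ler_wpM2r.
exists c; split=> //.
rewrite -{1 2}cT /T -scalerDl hh scale1r.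
by rewrite addrK.
Qed.

End CStarContinuity.

Section StarHom.
Variables (R : realType) (A B : cstarAlgType R) (f : A -> B).
Hypothesis fhom : star_hom f.

Lemma star_homM : {morph f : a b / a ** b}. Proof. by case: fhom. Qed.
Lemma star_hom_star : {morph f : a / star a}. Proof. by case: fhom. Qed.
Lemma star_homD : {morph f : a b / a + b}.
Proof. by case: fhom => l _ _ a b; rewrite -[a]scale1r l !scale1r. Qed.
Lemma star_hom0 : f 0 = 0.
Proof. by apply: (addrI (f 0)); rewrite -star_homD !addr0. Qed.
Lemma star_homZ (k : R[i]) a : f (k *: a) = k *: f a.
Proof. by case: fhom => l _ _; rewrite -[k *: a]addr0 l star_hom0 addr0. Qed.
Lemma star_homB : {morph f : a b / a - b}.
Proof. by move=> a b; rewrite star_homD -scaleN1r star_homZ scaleN1r. Qed.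
Lemma star_hom_sum (I : Type) (r : seq I) (P : pred I) (F : I -> A) :
  f (\sum_(i <- r | P i) F i) = \sum_(i <- r | P i) f (F i).
Proof. exact: (big_morph _ star_homD star_hom0). Qed.

(** Let h and d be the images of a and of the element c of
    [exists_sqrt_one_minus_square]. Then h + i (1 - d) is formally unitary; this
    gives |h b| <= |b| for every b, and b = h gives |h|^2 <= |h|. *)
Lemma star_hom_bound_small a : star a = a -> `|a| <= 2^-1 -> `|f a| <= 1.
Proof.
move=> aa /(exists_sqrt_one_minus_square aa)[c [cc ac cE]].
set h := f a; set d := f c.
have hh : star h = h by rewrite -star_hom_star aa.
have dd : star d = d by rewrite -star_hom_star cc.
have hd : h ** d = d ** h by rewrite -!star_homM ac.
have dE : d + d - d ** d = h ** h.
  by rewrite -!star_homM -star_homD -star_homB cE.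
have hb b : `|h ** b| <= `|b|.
  apply: (@norm_le_rotation _ _ _ (b - d ** b)).
    rewrite starB !starM hh dd cmulBl cmulBr -!cmulA; congr (_ - _ ** _).
    by rewrite !cmulA hd.
  rewrite starB !starM hh dd cmulBl !cmulBr -!cmulA.
  rewrite [h ** _]cmulA -dE cmulBl cmulDl cmulBr cmulDr -!cmulA.
  move: (star b ** b) (star b ** (d ** b)) (star b ** (d ** (d ** b))) => x y z.
  by rewrite -(addrA y y) -(addrA x) -opprD [LHS]addrC subrK.
have := hb h; rewrite -{1}hh cstar_identity expr2.
have [->|h0] := eqVneq `|h| 0; first by rewrite ler01.
by rewrite -[leRHS]mul1r ler_pM2r// lt_def h0 normr_ge0.
Qed.

(** Scaling gives the bound for self-adjoint elements, and the C*-identity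
    reduces the general case to a^* a. The best constant is 1, but any constant
    gives continuity. *)
Lemma star_hom_bounded a : `|f a| <= 2 * `|a|.
Proof.
have sa b : star b = b -> `|f b| <= 2 * `|b|.
  have [->|b0 bb] := eqVneq b 0; first by rewrite star_hom0 !normr0 mulr0.
  have n0 : 0 < 2 * `|b| by rewrite mulr_gt0// normr_gt0.
  have kn : `|(2 * `|b|)^-1| = (2 * `|b|)^-1.
    by rewrite ger0_norm// invr_ge0 ltW.
  have kk : conjc (2 * `|b|)^-1 = (2 * `|b|)^-1.
    rewrite -[X in conjc X]RRe_real ?conjc_real ?RRe_real// ger0_real//;
    by rewrite invr_ge0 ltW.
  rewrite -[leRHS]mulr1 -ler_pdivrMl// -[X in X * _]kn -normrZ -star_homZ.
  apply: star_hom_bound_small; first by rewrite starZ bb kk.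
  by rewrite normrZ kn invfM -mulrA mulVf ?mulr1// normr_eq0.
rewrite -(@ler_pXn2r _ 2)// ?nnegrE// ?mulr_ge0//.
rewrite -cstar_identity -star_hom_star -star_homM.
apply: (le_trans (sa _ _)); first by rewrite starM starK.
rewrite cstar_identity exprMn ler_wpM2r ?exprn_ge0//.
by rewrite -natrX ler_nat.
Qed.

Lemma star_hom_continuous : continuous f.
Proof. exact: bounded_additive_continuous star_homB star_hom_bounded. Qed.

End StarHom.

(** * Generators *)

Lemma star_hom_id (R : realType) (A : cstarAlgType R) : star_hom (@id A).
Proof. by []. Qed.

Lemma star_hom_comp (R : realType) (A B C : cstarAlgType R) (g : B -> C)
    (f : A -> B) : star_hom g -> star_hom f -> star_hom (g \o f).
Proof.
move=> [gl gM gs] [fl fM fs]; split=> [k a b|a b|a] /=.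
- by rewrite fl gl.
- by rewrite fM gM.
- by rewrite fs gs.
Qed.

Section Generation.
Variables (R : realType) (A : cstarAlgType R) (X : set A).
Hypothesis genX : generates X.

Lemma star_hom_eq_gen (B : cstarAlgType R) (f g : A -> B) :
  star_hom f -> star_hom g -> (forall x, X x -> f x = g x) -> f =1 g.
Proof.
move=> fh gh fgX a.
have /genX : closed [set x | f x = g x].
  exact: closed_fun_eq (star_hom_continuous fh) (star_hom_continuous gh).
move=> /(_ _ fgX) E; suff : [set x | f x = g x] a by [].
rewrite E//; split=> /=.
- by rewrite !star_hom0.
- move=> k x y fx fy; rewrite (star_homD fh) (star_homD gh).
  by rewrite (star_homZ fh) (star_homZ gh) fx fy.
- by move=> x y fx fy; rewrite (star_homM fh) (star_homM gh) fx fy.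
- by move=> x fx; rewrite (star_hom_star fh) (star_hom_star gh) fx.
Qed.

Lemma is_unit_gen (e : A) : star e = e ->
  (forall x, X x -> e ** x = x /\ x ** e = x) -> is_unit e.
Proof.
move=> ee eX a; pose S := [set x | e ** x = x] `&` [set x | x ** e = x].
suff : S a by [].
rewrite (genX (S := S))//.
- apply: closedI; apply: closed_fun_eq;
    by [exact: cmul_continuousl|exact: cmul_continuousr|move=> x; exact: cvg_id].
- split; rewrite /S /=.
  + by rewrite cmul0l cmul0r.
  + move=> k x y [ex xe] [ey ye].
    by rewrite cmulDl cmulDr -cscalerAr -cscalerAl ex xe ey ye.
  + by move=> x y [ex xe] [ey ye]; rewrite cmulA ex -cmulA ye.
  + by move=> x [ex xe]; rewrite -ee -!starM ex xe.
Qed.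

End Generation.

(** * Adding a summand C *)

Section Unitization.
Variables (R : realType) (A : cstarAlgType R).

Lemma star_hom_inl : star_hom (fun a : A => (a, 0 : R[i])).
Proof.
split=> [k a b|a b|a]; congr pair.
- by rewrite /= scaler0 addr0.
- by rewrite cmul0l.
- by rewrite star0.
Qed.

Lemma pair_decomp (x : A * R[i]) : x = (x.1, 0) + x.2 *: (0, 1).
Proof.
case: x => a k; congr pair; rewrite /= ?scaler0 ?addr0//.
by rewrite add0r [_ *: _]mulr1.
Qed.

Lemma summands_orth (a : A) : (0, 1 : R[i]) ** (a, 0) = 0.
Proof. by congr pair; [exact: cmul0l|exact: cmul0r]. Qed.

Lemma star_hom_unitization_eq (X : set A) (B : cstarAlgType R)
    (f g : A * R[i] -> B) : generates X -> star_hom f -> star_hom g ->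
  (forall x, X x -> f (x, 0) = g (x, 0)) -> f (0, 1) = g (0, 1) -> f =1 g.
Proof.
move=> genX fh gh fgX fg1 x.
have fgA : f \o (fun a => (a, 0)) =1 g \o (fun a => (a, 0)).
  apply: (star_hom_eq_gen genX) => //; exact: star_hom_comp star_hom_inl.
rewrite (pair_decomp x) (star_homD fh) (star_homD gh).
by rewrite (star_homZ fh) (star_homZ gh) fg1; congr (_ + _); exact: fgA.
Qed.

Lemma star_hom_add_projection (B : cstarAlgType R) (f : A -> B) (q : B) :
  star_hom f -> is_projection q -> (forall a, f a ** q = 0) ->
  star_hom (fun x : A * R[i] => f x.1 + x.2 *: q).
Proof.
move=> fh [qq qs] fq.
have qf a : q ** f a = 0.
  by rewrite -[a]starK star_hom_star// -qs -starM fq star0.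
split=> [k [a l] [b m]|[a l] [b m]|[a l]] /=.
- rewrite (star_homD fh) (star_homZ fh) [k *: l]/(k * l).
  by rewrite scalerDl scalerDr scalerA addrACA.
- rewrite (star_homM fh) cmulDl !cmulDr -!cscalerAr -!cscalerAl fq qf qq.
  by rewrite !scaler0 addr0 add0r scalerA mulrC.
- by rewrite (star_hom_star fh) starD starZ qs.
Qed.

End Unitization.

(** * Cuntz-Krieger families *)

Section GraphFamily.
Variables (R : realType) (V E : countType) (G : digraph V E).

Lemma star_hom_fsum (A B : cstarAlgType R) (f : A -> B) (D : set E)
    (F : E -> A) :
  star_hom f -> finite_set D ->
  f (\sum_(e \in D) F e) = \sum_(e \in D) f (F e).
Proof. by move=> fh finD; rewrite !fsbig_finite// (star_hom_sum fh). Qed.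

Lemma graph_family_star_hom (A B : cstarAlgType R) (f : A -> B) p s :
  star_hom f -> graph_family G p s -> graph_family G (f \o p) (f \o s).
Proof.
move=> fh [pp po si so ss sv sr].
have fss e : f (s e) ** star (f (s e)) = f (s e ** star (s e)).
  by rewrite (star_homM fh) (star_hom_star fh).
split=> [v|v w vw|e|e e' ee'|e|v rv rv0 rvf|e] /=.
- by have [ppv psv] := pp v; split;
    rewrite -?(star_homM fh) ?ppv -?(star_hom_star fh) ?psv.
- by rewrite /proj_orthogonal -(star_homM fh) po// (star_hom0 fh).
- by rewrite /partial_isometry fss -(star_homM fh) si.
- by rewrite /proj_orthogonal !fss -(star_homM fh) so// (star_hom0 fh).
- by rewrite -(star_hom_star fh) -(star_homM fh) ss.
- by rewrite sv// star_hom_fsum//; apply: eq_fsbigr => e _; rewrite fss.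
- by rewrite /proj_le fss -(star_homM fh) sr.
Qed.

Section OneFamily.
Variables (A : cstarAlgType R) (p : V -> A) (s : E -> A).
Hypothesis fam : graph_family G p s.

Lemma gf_cmul_vert v w : p v ** p w = if v == w then p v else 0.
Proof.
have [<-|vw] := eqVneq v w; first by case: (gf_proj fam v).
exact: (gf_proj_orth fam vw).
Qed.

Lemma gf_rng_edge e : p (rng G e) ** s e = s e.
Proof.
by rewrite -[in LHS](gf_pisom fam e) cmulA (gf_range fam) (gf_pisom fam).
Qed.

Lemma gf_edge_src e : s e ** p (src G e) = s e.
Proof. by rewrite -(gf_source fam) cmulA (gf_pisom fam). Qed.

End OneFamily.
End GraphFamily.

Section FiniteVertices.
Variables (R : realType) (V : finType) (E : countType) (G : digraph V E).
Variables (A : cstarAlgType R) (p : V -> A) (s : E -> A).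
Hypothesis fam : graph_family G p s.

Lemma gf_cmul_sum (P Q : pred V) :
  (\sum_(v | P v) p v) ** (\sum_(v | Q v) p v) = \sum_(v | P v && Q v) p v.
Proof.
rewrite cmul_suml big_mkcondr; apply: eq_bigr => v _.
rewrite cmul_sumr; case: ifPn => Qv.
  rewrite (bigD1 v)//= (gf_cmul_vert fam) eqxx big1 ?addr0// => w /andP[_ wv].
  by rewrite (gf_cmul_vert fam) eq_sym (negPf wv).
rewrite big1// => w Qw; rewrite (gf_cmul_vert fam); case: eqP => // vw.
by rewrite vw Qw in Qv.
Qed.

Lemma gf_sum_projection (P : pred V) : is_projection (\sum_(v | P v) p v).
Proof.
split; first by rewrite gf_cmul_sum; apply: eq_bigl => v; rewrite andbb.
by rewrite star_sum; apply: eq_bigr => v _; case: (gf_proj fam v).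
Qed.

Lemma gf_sum_cmul_vert v : (\sum_w p w) ** p v = p v.
Proof. by have := gf_cmul_sum predT (pred1 v); rewrite !big_pred1_eq. Qed.

Lemma gf_vert_cmul_sum v : p v ** (\sum_w p w) = p v.
Proof.
have := gf_cmul_sum (pred1 v) predT.
by under [RHS]eq_bigl do rewrite andbT; rewrite !big_pred1_eq.
Qed.

End FiniteVertices.

Lemma graph_algebra_unit (R : realType) (V : finType) (E : countType)
    (G : digraph V E) (A : cstarAlgType R) (p : V -> A) (s : E -> A) :
  graph_algebra G p s -> is_unit (\sum_v p v).
Proof.
move=> [fam gen _]; apply: (is_unit_gen gen).
  by case: (gf_sum_projection fam predT).
move=> _ [[v _ <-]|[e _ <-]].
  by rewrite (gf_sum_cmul_vert fam) (gf_vert_cmul_sum fam).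
split.
  rewrite -{1}(gf_rng_edge fam e) cmulA (gf_sum_cmul_vert fam).
  exact: gf_rng_edge.
rewrite -{1}(gf_edge_src fam e) -cmulA (gf_vert_cmul_sum fam).
exact: gf_edge_src.
Qed.

(** * Restricting and gluing families along subgraphs *)

Lemma cover_ind (T : Type) (P1 P2 : pred T) (Q : T -> Prop) :
  (forall x, P1 x || P2 x) -> (forall x : {x | P1 x}, Q (val x)) ->
  (forall x : {x | P2 x}, Q (val x)) -> forall x, Q x.
Proof.
move=> cover Q1 Q2 x; have /orP[Px|Px] := cover x.
  exact: (Q1 (exist _ x Px)).
exact: (Q2 (exist _ x Px)).
Qed.

Section GlueFun.
Variables (T : Type) (X : eqType) (P1 P2 : pred X).
Variables (f1 : {x | P1 x} -> T) (f2 : {x | P2 x} -> T) (d : T).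

(** The value d is never reached when P1 and P2 cover X. *)
Definition glue_fun (x : X) : T :=
  if insub x is Some x1 then f1 x1 else
  if insub x is Some x2 then f2 x2 else d.

Lemma glue_fun1 : glue_fun \o val = f1.
Proof. by apply/funext => x; rewrite /glue_fun /= valK. Qed.

Lemma glue_fun2 : (forall x1 x2, val x1 = val x2 -> f1 x1 = f2 x2) ->
  glue_fun \o val = f2.
Proof.
move=> f12; apply/funext => x; rewrite /glue_fun /= valK.
by case: insubP => // x1 _ /f12.
Qed.

End GlueFun.

Section Saturated.
Variables (R : realType) (V E : countType) (G : digraph V E).

(** The sum relation at a vertex that receives an edge of H then involves only
    edges of H, so that it is the same in H and in G. *)
Definition range_saturated (H : subgraph G) :=
  forall e f, rng G e = rng G f -> sg_edge H e -> sg_edge H f.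

Section Fiber.
Variables (H : subgraph G) (satH : range_saturated H).
Variables (x : {v | sg_vert H v}).
Let GH := subgraph_digraph H.

(** Without an edge of H that enters x, the edges of G that enter x could all
    lie outside H. *)
Lemma saturated_fiber : rng GH @^-1` [set x] !=set0 ->
  rng G @^-1` [set val x] = val @` (rng GH @^-1` [set x]).
Proof.
move=> [e0 <-]; apply/seteqP; split=> [e /= ee0|_ [e /= /(congr1 val) ev <-]//].
have He : sg_edge H e by apply: satH (valP e0); rewrite ee0.
by exists (exist _ e He) => //=; apply: val_inj.
Qed.

Lemma saturated_fiber_finite : rng GH @^-1` [set x] !=set0 ->
  finite_set (rng G @^-1` [set val x]) = finite_set (rng GH @^-1` [set x]).
Proof.
move=> /saturated_fiber->; apply/eq_finite_set/inj_card_eq => ? ? _ _.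
exact: val_inj.
Qed.

Lemma saturated_fiber_sum (B : cstarAlgType R) (F : E -> B) :
  rng GH @^-1` [set x] !=set0 ->
  \sum_(e \in rng G @^-1` [set val x]) F e =
  \sum_(e \in rng GH @^-1` [set x]) F (val e).
Proof.
by move=> /saturated_fiber->; rewrite fsbig_image// => ? ? _ _; exact: val_inj.
Qed.

End Fiber.

(** The other relations restrict to any subgraph. Saturation is there for the
    sum relation, which would change if a vertex lost only a part of its
    incoming edges. *)
Lemma graph_family_restrict (H : subgraph G) (B : cstarAlgType R) p s :
  range_saturated H -> @graph_family R V E G B p s ->
  graph_family (subgraph_digraph H) (p \o val) (s \o val).
Proof.
move=> satH [pp po si so ss sv sr].
split=> [v|v w vw|e|e e' ee'|e|v rv rv0 rvf|e] /=.
- exact: pp.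
- exact: po.
- exact: si.
- exact: so.
- exact: ss.
- rewrite sv ?(saturated_fiber_sum satH)// ?(saturated_fiber_finite satH)//.
  by rewrite saturated_fiber//; case: rv0 => e ev; exists (val e), e.
- exact: sr.
Qed.

Lemma gf_vertex_of_subgraph (H : subgraph G) (B : cstarAlgType R)
    (p : V -> B) (s : E -> B) (e : E) :
  range_saturated H ->
  graph_family (subgraph_digraph H) (p \o val) (s \o val) -> sg_edge H e ->
  finite_set (rng G @^-1` [set rng G e]) ->
  p (rng G e) = \sum_(f \in rng G @^-1` [set rng G e]) (s f ** star (s f)).
Proof.
move=> satH fam He; set x := rng (subgraph_digraph H) (exist _ e He).
have x0 : rng (subgraph_digraph H) @^-1` [set x] !=set0.
  by exists (exist _ e He).
rewrite -[rng G e]/(val x) (saturated_fiber_finite satH x0).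
by rewrite (saturated_fiber_sum satH) //; exact: (gf_vertex fam x0).
Qed.

(** Two edges with the same range lie in the same subgraph, and edges with
    different ranges have orthogonal range projections because the projections
    of the vertices are orthogonal. So the orthogonality of the two families
    needs to be assumed only for the vertices. *)
Lemma graph_family_glue (H1 H2 : subgraph G) (B : cstarAlgType R)
    (p : V -> B) (s : E -> B) :
  range_saturated H1 -> range_saturated H2 ->
  (forall v, sg_vert H1 v || sg_vert H2 v) ->
  (forall e, sg_edge H1 e || sg_edge H2 e) ->
  graph_family (subgraph_digraph H1) (p \o val) (s \o val) ->
  graph_family (subgraph_digraph H2) (p \o val) (s \o val) ->
  (forall v w, ~~ sg_vert H2 v -> ~~ sg_vert H1 w -> p v ** p w = 0) ->
  graph_family G p s.
Proof.
move=> sat1 sat2 cV cE fam1 fam2 p12.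
have pp : forall v, is_projection (p v).
  by apply: (cover_ind cV) => v; [exact: gf_proj fam1 v|exact: gf_proj fam2 v].
have sr : forall e, proj_le (s e ** star (s e)) (p (rng G e)).
  apply: (cover_ind cE) => e;
    by [exact: gf_range fam1 e|exact: gf_range fam2 e].
have po v w : v != w -> proj_orthogonal (p v) (p w).
  move=> vw; have [v1|v1] := boolP (sg_vert H1 v); last first.
    have [w2|w2] := boolP (sg_vert H2 w); last first.
      by rewrite /proj_orthogonal -(pp v).2 -(pp w).2 -starM p12// star0.
    have v2 : sg_vert H2 v by have := cV v; rewrite (negPf v1).
    exact: (gf_proj_orth fam2 (v := exist _ v v2) (w := exist _ w w2)).
  have [w1|w1] := boolP (sg_vert H1 w).
    exact: (gf_proj_orth fam1 (v := exist _ v v1) (w := exist _ w w1)).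
  have [v2|v2] := boolP (sg_vert H2 v); last exact: p12.
  have w2 : sg_vert H2 w by have := cV w; rewrite (negPf w1).
  exact: (gf_proj_orth fam2 (v := exist _ v v2) (w := exist _ w w2)).
have so_rng e f : rng G e != rng G f ->
    proj_orthogonal (s e ** star (s e)) (s f ** star (s f)).
  move=> /po ef; rewrite /proj_orthogonal -(sr f) -[s e ** _]starK starM starK.
  rewrite -[s e ** _](sr e) starM (pp _).2.
  by rewrite cmulA -[_ ** _ ** p (rng G f)]cmulA ef cmul0r cmul0l.
split=> // [|e f ef||v /= [e <-]].
- apply: (cover_ind cE) => e;
    by [exact: gf_pisom fam1 e|exact: gf_pisom fam2 e].
- have [/eqP rr|] := boolP (rng G e == rng G f); last exact: so_rng.
  have /orP[He|He] := cE e.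
    have Hf := sat1 _ _ rr He.
    exact: (gf_range_orth fam1 (e := exist _ e He) (f := exist _ f Hf)).
  have Hf := sat2 _ _ rr He.
  exact: (gf_range_orth fam2 (e := exist _ e He) (f := exist _ f Hf)).
- apply: (cover_ind cE) => e;
    by [exact: gf_source fam1 e|exact: gf_source fam2 e].
- have /orP[He|He] := cE e; first exact: gf_vertex_of_subgraph sat1 fam1 He.
  exact: gf_vertex_of_subgraph sat2 fam2 He.
Qed.

End Saturated.

(** * The maps from the two summands to C*(G) *)

Lemma sum_subgraph_compl (V : finType) (E : countType) (G : digraph V E)
    (G1 G2 : subgraph G) (coverV : forall x, sg_vert G1 x || sg_vert G2 x)
    (A : nmodType) (F : V -> A) :
  \sum_(x : {x | sg_vert G1 x} | ~~ sg_vert G2 (val x)) F (val x) =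
  \sum_(x | ~~ sg_vert G2 x) F x.
Proof.
rewrite -(big_sub_cond (sg_vert G1) (fun x => ~~ sg_vert G2 x)).
apply: eq_bigl => x; have := coverV x.
by rewrite /in_mem /=; case: (sg_vert G1 x) => //= ->.
Qed.

Section Unitized.
Variables (R : realType) (V : finType) (E : countType) (G : digraph V E).
Variables (A : cstarAlgType R) (p : V -> A) (s : E -> A).
Hypothesis graphA : graph_algebra G p s.

(** The unit of C*(H) goes to the sum of the p_v over H. The extra summand C is
    sent to the sum over the other vertices, which makes the map unital. *)
Lemma unitized_subgraph_hom (H : subgraph G) (B : cstarAlgType R)
    (q : {v | sg_vert H v} -> B) (t : {e | sg_edge H e} -> B) :
  range_saturated H -> graph_algebra (subgraph_digraph H) q t ->
  exists f : B -> A,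
    [/\ star_hom f, f \o q =1 p \o val, f \o t =1 s \o val &
        unital_star_hom (fun x : B * R[i] =>
          f x.1 + x.2 *: \sum_(v | ~~ sg_vert H v) p v)].
Proof.
move=> satH graphB; have [famA _ _] := graphA.
have [f [fh fq ft]] := ga_univ graphB (graph_family_restrict satH famA).
set r := \sum_(v | _) p v.
have uB := graph_algebra_unit graphB; have uA := graph_algebra_unit graphA.
have f1 : f (\sum_x q x) = \sum_(v | sg_vert H v) p v.
  rewrite (star_hom_sum fh) [RHS](big_sub (sg_vert H)).
  by apply: eq_bigr => x _; exact: fq.
(* f b = f b ** f 1 is supported on the vertices of H. *)
have fr b : f b ** r = 0.
  have [_ <-] := uB b; rewrite (star_homM fh) f1 -cmulA (gf_cmul_sum famA).
  by rewrite big1 ?cmul0r// => v /andP[->].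
exists f; split=> //; split.
  exact: star_hom_add_projection (gf_sum_projection famA _) fr.
exists (\sum_x q x, 1) => [[b k]|] /=.
  have [l1 l2] := uB b; split; congr pair => //=.
    by rewrite [_ ** _]mul1r.
  by rewrite [_ ** _]mulr1.
by rewrite f1 scale1r -(bigID (sg_vert H) predT).
Qed.

End Unitized.

(** * The amalgamating maps on the standard basis *)

Section Theta.
Variables (R : realType) (V : finType) (E : countType) (G : digraph V E).
Variables (G1 G2 : subgraph G) (n : nat) (v : 'I_n -> V).

Let basis (j : 'I_(n + 2)) : 'rV[R[i]]_(n + 2) := delta_mx 0 j.

Lemma sum_basis (A : cstarAlgType R) (F : 'I_n -> A) i :
  \sum_(j < n) basis (lshift 2 i) 0 (lshift 2 j) *: F j = F i.
Proof.
rewrite (bigD1 i)//= big1 => [|j ji]; rewrite mxE eqxx.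
  by rewrite eqxx scale1r addr0.
by rewrite eq_lshift (negPf ji) scale0r.
Qed.

Lemma sum_basis_rshift (A : cstarAlgType R) (F : 'I_n -> A) k :
  \sum_(j < n) basis (rshift n k) 0 (lshift 2 j) *: F j = 0.
Proof. by rewrite big1// => j _; rewrite mxE eq_lrshift andbF scale0r. Qed.

Section ThetaValues.
Variables (A : cstarAlgType R) (vG1 : forall i, sg_vert G1 (v i)).
Variables (B : cstarAlgType R) (vG2 : forall i, sg_vert G2 (v i)).
Variables (q1 : {x | sg_vert G1 x} -> A) (q2 : {x | sg_vert G2 x} -> B).

Lemma theta1_lshift i :
  theta1 G2 q1 vG1 (basis (lshift 2 i)) = (q1 (exist _ (v i) (vG1 i)), 0).
Proof.
congr pair; last by rewrite mxE eq_rlshift andbF.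
by rewrite sum_basis mxE eq_rlshift andbF scale0r addr0.
Qed.

Lemma theta1_ord0 : theta1 G2 q1 vG1 (basis (rshift n ord0)) =
  (\sum_(x | ~~ sg_vert G2 (val x)) q1 x, 0).
Proof.
congr pair; last by rewrite mxE eq_rshift.
by rewrite sum_basis_rshift mxE !eqxx scale1r add0r.
Qed.

Lemma theta1_ord_max : theta1 G2 q1 vG1 (basis (rshift n ord_max)) = (0, 1).
Proof.
congr pair; last by rewrite mxE !eqxx.
by rewrite sum_basis_rshift mxE add0r eq_rshift scale0r.
Qed.

Lemma theta2_lshift i :
  theta2 G1 q2 vG2 (basis (lshift 2 i)) = (q2 (exist _ (v i) (vG2 i)), 0).
Proof.
congr pair; last by rewrite mxE eq_rlshift andbF.
by rewrite sum_basis mxE eq_rlshift andbF scale0r addr0.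
Qed.

Lemma theta2_ord_max : theta2 G1 q2 vG2 (basis (rshift n ord_max)) =
  (\sum_(x | ~~ sg_vert G1 (val x)) q2 x, 0).
Proof.
congr pair; last by rewrite mxE eq_rshift.
by rewrite sum_basis_rshift mxE !eqxx scale1r add0r.
Qed.

Lemma theta2_ord0 : theta2 G1 q2 vG2 (basis (rshift n ord0)) = (0, 1).
Proof.
congr pair; last by rewrite mxE !eqxx.
by rewrite sum_basis_rshift mxE add0r eq_rshift scale0r.
Qed.

End ThetaValues.
End Theta.

(** * The isomorphism *)

Theorem theorem3p3 (R : realType) (V : finType) (E : countType)
    (G : digraph V E) (G1 G2 : subgraph G)
    (* G = G1 U G2, with no common edge *)
    (coverV : forall x : V, sg_vert G1 x || sg_vert G2 x)
    (coverE : forall e : E, sg_edge G1 e || sg_edge G2 e)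
    (disjE : forall e : E, ~~ (sg_edge G1 e && sg_edge G2 e))
    (G1_nonempty : exists x : V, sg_vert G1 x)
    (G2_nonempty : exists x : V, sg_vert G2 x)
    (G2_proper : exists x : V, ~~ sg_vert G2 x)
    (no_entry : forall e : E, sg_edge G2 e -> ~~ sg_vert G1 (rng G e))
    (* v enumerates the shared vertices without repetition *)
    (n : nat) (v : 'I_n -> V) (v_inj : injective v)
    (vG1 : forall i : 'I_n, sg_vert G1 (v i))
    (vG2 : forall i : 'I_n, sg_vert G2 (v i))
    (v_all : forall x : V, sg_vert G1 x -> sg_vert G2 x -> exists i, v i = x)
    (* A = C*(G), A1 = C*(G1), A2 = C*(G2) *)
    (A : cstarAlgType R) (p : V -> A) (s : E -> A)
    (A1 : cstarAlgType R) (p1 : {x : V | sg_vert G1 x} -> A1)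
    (s1 : {e : E | sg_edge G1 e} -> A1)
    (A2 : cstarAlgType R) (p2 : {x : V | sg_vert G2 x} -> A2)
    (s2 : {e : E | sg_edge G2 e} -> A2)
    (graphA : graph_algebra G p s)
    (graphA1 : graph_algebra (subgraph_digraph G1) p1 s1)
    (graphA2 : graph_algebra (subgraph_digraph G2) p2 s2)
    (* F is the amalgamated free product of A1 (+) C and A2 (+) C *)
    (F : cstarAlgType R)
    (i1 : (A1 * R[i])%type -> F) (i2 : (A2 * R[i])%type -> F)
    (freeF : amalgamated_free_product (theta1 G2 p1 vG1) (theta2 G1 p2 vG2)
               i1 i2) :
  star_isomorphic A F.
Proof.
have sat1 : range_saturated G1.
  move=> e f ef e1; have /orP[//|/no_entry] := coverE f.
  by rewrite -ef (sg_rng e1).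
have sat2 : range_saturated G2.
  move=> e f ef e2; have /orP[f1|//] := coverE f.
  by have := no_entry _ e2; rewrite ef (sg_rng f1).
have coverV' x : sg_vert G2 x || sg_vert G1 x by rewrite orbC.
have [f1 [f1h f1p f1s pi1h]] := unitized_subgraph_hom graphA sat1 graphA1.
have [f2 [f2h f2p f2s pi2h]] := unitized_subgraph_hom graphA sat2 graphA2.
have [|psi [[psih _] psi1 psi2]] := afp_univ freeF pi1h pi2h.
  move=> l; rewrite /theta1 /theta2 /=.
  rewrite (star_homD f1h) (star_homD f2h) (star_homZ f1h) (star_homZ f2h).
  rewrite !(star_hom_sum f1h, star_hom_sum f2h).
  (* The last two terms are exchanged: each sum over a difference comes from the
     summand C on one side and from the subgraph on the other. *)
  rewrite addrAC -!addrA; congr (_ + _).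
    apply: eq_bigr => i _; rewrite (star_homZ f1h) (star_homZ f2h).
    by congr (_ *: _); rewrite [LHS]f1p [RHS]f2p.
  congr (_ *: _ + _ *: _).
    rewrite -(sum_subgraph_compl coverV'); apply: eq_bigr => x _.
    exact: esym (f2p x).
  rewrite -(sum_subgraph_compl coverV); apply: eq_bigr => x _.
  exact: f1p x.
have [[i1h _] _] := afp_embA freeF; have [[i2h _] _] := afp_embB freeF.
have amalg := afp_amalg freeF.
(* Amalgamation on the standard basis of C^(n+2). *)
have i12v x1 x2 : val x1 = val x2 -> i1 (p1 x1, 0) = i2 (p2 x2, 0).
  move=> x12; have x1G2 := etrans (congr1 _ x12) (valP x2).
  have [i vi] := v_all _ (valP x1) x1G2.
  have -> : x1 = exist _ (v i) (vG1 i) by apply: val_inj.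
  have -> : x2 = exist _ (v i) (vG2 i) by apply: val_inj; rewrite /= vi x12.
  rewrite -(theta1_lshift G2 vG1 p1) -(theta2_lshift G1 vG2 p2).
  exact: amalg.
have i1_e : i1 (0, 1) = i2 (\sum_(x | ~~ sg_vert G1 (val x)) p2 x, 0).
  by rewrite -(theta1_ord_max G2 vG1 p1) -(theta2_ord_max G1 vG2); exact: amalg.
have i2_e : i2 (0, 1) = i1 (\sum_(x | ~~ sg_vert G2 (val x)) p1 x, 0).
  rewrite -(theta2_ord0 G1 vG2 p2) -(theta1_ord0 G2 vG1).
  by symmetry; exact: amalg.
have j1h := star_hom_comp i1h (star_hom_inl A1).
have j2h := star_hom_comp i2h (star_hom_inl A2).
set j1 := i1 \o _ in j1h; set j2 := i2 \o _ in j2h.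
pose P := glue_fun (j1 \o p1) (j2 \o p2) 0.
pose S := glue_fun (j1 \o s1) (j2 \o s2) 0.
have P1 : P \o val = j1 \o p1 by exact: glue_fun1.
have P2 : P \o val = j2 \o p2 by apply: glue_fun2 => x1 x2 /i12v.
have S1 : S \o val = j1 \o s1 by exact: glue_fun1.
have S2 : S \o val = j2 \o s2.
  apply: glue_fun2 => -[e1 e1P] [e2 e2P] /= ee; case/negP: (disjE e1).
  by rewrite e1P ee e2P.
have [phi [phih phip phis]] : exists phi : A -> F,
    [/\ star_hom phi, phi \o p =1 P & phi \o s =1 S].
  apply: (ga_univ graphA); apply: (graph_family_glue sat1 sat2) => //.
  - by rewrite P1 S1; apply: graph_family_star_hom j1h (ga_family graphA1).
  - by rewrite P2 S2; apply: graph_family_star_hom j2h (ga_family graphA2).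
  move=> x y x2 y1.
  have x1 : sg_vert G1 x by have := coverV x; rewrite (negPf x2) orbF.
  have y2 : sg_vert G2 y by have := coverV y; rewrite (negPf y1).
  have -> : P x = j1 (p1 (exist _ x x1)) by rewrite -[RHS]/((j1 \o p1) _) -P1.
  have -> : P y = j2 (p2 (exist _ y y2)) by rewrite -[RHS]/((j2 \o p2) _) -P2.
  (* p_x lies below the sum over G1 \ G2, which amalgamation turns into the
     unit (0, 1) of the other extra summand. *)
  have <- : p1 (exist _ x x1) ** (\sum_(x | ~~ sg_vert G2 (val x)) p1 x) =
            p1 (exist _ x x1).
    have := gf_cmul_sum (ga_family graphA1) (pred1 (exist _ x x1))
      (fun x => ~~ sg_vert G2 (val x)).
    rewrite big_pred1_eq => ->; rewrite (big_pred1 (exist _ x x1))// => z /=.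
    by case: eqP => //= ->.
  rewrite (star_homM j1h) -cmulA (esym i2_e : j1 _ = _).
  by rewrite /j2 /= -(star_homM i2h) summands_orth (star_hom0 i2h) cmul0r.
(* psi inverts phi on the generators of A. *)
have psiP : forall x, psi (P x) = p x.
  apply: (cover_ind coverV) => x; rewrite -[P _]/((P \o val) x).
    by rewrite P1 [LHS]psi1 /= scale0r addr0; exact: f1p.
  by rewrite P2 [LHS]psi2 /= scale0r addr0; exact: f2p.
have psiS : forall e, psi (S e) = s e.
  apply: (cover_ind coverE) => e; rewrite -[S _]/((S \o val) e).
    by rewrite S1 [LHS]psi1 /= scale0r addr0; exact: f1s.
  by rewrite S2 [LHS]psi2 /= scale0r addr0; exact: f2s.
have phi_sum1 : phi (\sum_(x | ~~ sg_vert G1 x) p x) = i1 (0, 1).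
  rewrite i1_e -[RHS]/(j2 _) (star_hom_sum phih) (star_hom_sum j2h).
  rewrite -(sum_subgraph_compl coverV'); apply: eq_bigr => x _.
  by rewrite [LHS]phip -[RHS]/((j2 \o p2) x) -P2.
have phi_sum2 : phi (\sum_(x | ~~ sg_vert G2 x) p x) = i2 (0, 1).
  rewrite i2_e -[RHS]/(j1 _) (star_hom_sum phih) (star_hom_sum j1h).
  rewrite -(sum_subgraph_compl coverV); apply: eq_bigr => x _.
  by rewrite [LHS]phip -[RHS]/((j1 \o p1) x) -P1.
exists phi => //; exists psi.
  apply: (star_hom_eq_gen (ga_gen graphA) _ (star_hom_id A)).
    exact: star_hom_comp psih phih.
  move=> _ [[x _ <-]|[e _ <-]] /=.
    by rewrite [phi _]phip psiP.
  by rewrite [phi _]phis psiS.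
apply: (star_hom_eq_gen (afp_gen freeF) _ (star_hom_id F)).
  exact: star_hom_comp phih psih.
have i1E : phi \o psi \o i1 =1 i1.
  apply: (star_hom_unitization_eq (ga_gen graphA1)) => //.
  - exact: star_hom_comp (star_hom_comp phih psih) i1h.
  - move=> _ [[x _ <-]|[e _ <-]] /=; rewrite [psi _]psi1 /= scale0r addr0.
      by rewrite [f1 _]f1p [LHS]phip -[LHS]/((P \o val) x) P1.
    by rewrite [f1 _]f1s [LHS]phis -[LHS]/((S \o val) e) S1.
  - by rewrite /= [psi _]psi1 /= (star_hom0 f1h) scale1r add0r.
have i2E : phi \o psi \o i2 =1 i2.
  apply: (star_hom_unitization_eq (ga_gen graphA2)) => //.
  - exact: star_hom_comp (star_hom_comp phih psih) i2h.
  - move=> _ [[x _ <-]|[e _ <-]] /=; rewrite [psi _]psi2 /= scale0r addr0.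
      by rewrite [f2 _]f2p [LHS]phip -[LHS]/((P \o val) x) P2.
    by rewrite [f2 _]f2s [LHS]phis -[LHS]/((S \o val) e) S2.
  - by rewrite /= [psi _]psi2 /= (star_hom0 f2h) scale1r add0r.
by move=> _ [[a _ <-]|[a _ <-]]; [exact: i1E|exact: i2E].
Qed.
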